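(* Let $K$ be the algebraic closure of a finite field $\mathbb{F}_q$ of characteristic $p$. Let $\alpha_1,\dots,\alpha_r\in K$ be pairwise distinct and let $m\ge2$ be an integer with $p\nmid m$ and $\gcd(m,r)=1$. Let $\mathcal{F}=K(x,y)$ be the function field of the curve $y^m=\prod_{i=1}^r(x-\alpha_i)$, let $Q_\infty$ be the only place of $\mathcal{F}$ over the pole of $x$ in $K(x)$, and let $Q\ne Q_\infty$ be a place of $\mathcal{F}$ that is totally ramified in the extension $\mathcal{F}/K(x)$. Then $$G(Q)=\left\{mj-i\ \middle|\ 1\le j\le r-1,\ \left\lfloor\frac{jm}{r}\right\rfloor+1\le i\le m-1\right\},$$ where $i,j$ range over integers.
   Context: $\mathbb{N}=\{0,1,2,\dots\}$. For a place $P$ of the function field $\mathcal{F}/K$, the Weierstrass semigroup is $H(P)=\{s\in\mathbb{N}\mid (z)_\infty=sP\text{ for some }z\in\mathcal{F}\}$, where $(z)_\infty$ is the pole divisor of $z$, and the gap set is $G(P)=\mathbb{N}\setminus H(P)$. $\lfloor\cdot\rfloor$ is the floor function. *)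

(* Defs.v *)
From HB Require Import structures.
From mathcomp Require Import all_boot all_order all_algebra all_field.
From mathcomp Require Import boolp classical_sets.

Set Implicit Arguments.
Unset Strict Implicit.
Unset Printing Implicit Defensive.

Import Order.TTheory GRing.Theory Num.Theory.
Local Open Scope classical_set_scope.
Local Open Scope ring_scope.

Section Places.
Variables (K L : fieldType) (c : {rmorphism K -> L}).

(* A place P is given by its valuation ring O_P, a ring K < O_P < L (both
   inclusions strict, K being identified with its image under c); P itself is
   the maximal ideal of O_P, and each of P and O_P determines the other. *)
Record place := Place {
  valuation_ring : set L;
  valuation_ring_subring : subring_closed [in valuation_ring];
  valuation_ring_const : range c `<` valuation_ring;
  valuation_ring_proper : valuation_ring `<` [set: L];
  valuation_ring_total :
    forall z, valuation_ring z \/ valuation_ring z^-1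
}.

Definition valuation_units (P : place) : set L :=
  [set u | [/\ u != 0, valuation_ring P u & valuation_ring P u^-1]].

Definition maximal_ideal (P : place) : set L :=
  valuation_ring P `\` valuation_units P.

Definition prime_element (P : place) (t : L) : Prop :=
  maximal_ideal P = [set t * u | u in valuation_ring P].

(* v_P(z) = n when z = t ^ n u with t a prime element for P and u a unit of
   O_P. No n qualifies for z = 0, so valuation P 0 is the default value 0,
   whereas v_P(0) is usually infinite. *)
Definition valuation (P : place) (z : L) : int :=
  xget 0 [set n | exists t u,
    [/\ prime_element P t, valuation_units P u & z = t ^ n * u]].

Definition is_pole (P : place) (z : L) : Prop := valuation P z < 0.

(* Divisors are represented by their coefficients. *)
Definition divisor := place -> int.

Definition pole_divisor (z : L) : divisor :=
  fun P => Num.max 0 (- valuation P z).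

Definition multiple_of_place (s : nat) (P : place) : divisor :=
  fun P' => if `[< P' = P >] then s%:Z else 0.

Definition weierstrass_semigroup (P : place) : set nat :=
  [set s | exists z, z != 0 /\ pole_divisor z = multiple_of_place s P].

Definition gap_set (P : place) : set nat := ~` weierstrass_semigroup P.

End Places.

Notation ratfun K := {fraction {poly K}}.

Definition ratfun_const (K : fieldType) : {rmorphism K -> ratfun K} :=
  @tofrac {poly K} \o polyC.

Definition ratfun_X (K : fieldType) : ratfun K := tofrac 'X.

Section Extension.
Variables (K : fieldType) (F : fieldExtType (ratfun K)).

Definition ext_const : {rmorphism K -> F} :=
  GRing.in_alg F \o @ratfun_const K.

Definition lies_over (P' : place ext_const) (P : place (@ratfun_const K)) :=
  valuation_ring P = [set z | valuation_ring P' z%:A].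

Definition is_ramification_index
    (P' : place ext_const) (P : place (@ratfun_const K)) (e : nat) : Prop :=
  forall z : ratfun K, z != 0 -> valuation P' z%:A = e%:Z * valuation P z.

Definition totally_ramified (P' : place ext_const) : Prop :=
  exists P, lies_over P' P /\ is_ramification_index P' P (\dim {:F}).

End Extension.

(* Main.v *)
Require Import Defs.
From HB Require Import structures.
From mathcomp Require Import all_boot all_order all_algebra all_field.
From mathcomp Require Import boolp classical_sets.
From mathcomp Require Import zify ring.
Set Implicit Arguments.
Unset Strict Implicit.
Unset Printing Implicit Defensive.
Import Order.TTheory GRing.Theory Num.Theory.
Local Open Scope classical_set_scope.
Local Open Scope ring_scope.

(** Write f for the product of the x - alpha_i. Why the theorem is true:

    A place where x has a pole is totally ramified, because m is prime to r: the
    functions y^i with i < m have orders there that are distinct modulo m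
    ([pole_uniformizer], [evF_order_pole]). Hence there is one such place only,
    and 1, y, .., y^(m-1) are independent over K(x) ([evF_inj0]), so evaluation
    at a point (a, b) with b^m = f(a) is well defined on polynomials in x and y
    ([ev_at_evF0]). The functions with a value at (a, b) form a discrete
    valuation ring, with prime element x - a if f(a) <> 0 and y if f(a) = 0;
    every place where x is regular arises in this way ([place_classification]).
    In the first case x - a has order 1, so a totally ramified place Q other
    than the one at infinity sits at a branch point (a, 0)
    ([totally_ramified_branch]), where y has order 1 and x - a has order m.

    If i < m and r i <= m k, the function y^i / (x - a)^k has a pole of order
    m k - i at Q and no other pole ([semigroup_mem]). These are all the pole
    numbers. Indeed let z have a pole of order s = m j - i at Q and no other
    pole. Being regular at all the other points above every value of x, it
    becomes a polynomial G(x, y) of degree below m in y after multiplication by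
    some power (x - a)^k ([clear_denominators_at]). The orders at Q of the terms
    g_l(x) y^l of G are distinct modulo m, so the term that determines the order
    of G is the one with l = i, and g_i vanishes at a to the order k - j exactly;
    so its degree is at least k - j. The orders of the terms at infinity are
    distinct too, so regularity of z at infinity bounds each term, and gives
    m (k - j) + r i <= m k, that is r i <= m j ([gap_mem]).

    Hence s is a gap if and only if s = m j - i with 0 <= i < m and m j < r i
    ([gap_setP]). *)

(** * Valuation rings *)

Section ValuationRings.
Variables (K L : fieldType) (c : {rmorphism K -> L}).
Implicit Types (P : place c) (t z u : L).

Lemma vring1 P : valuation_ring P 1.
Proof. by have [h _ _] := valuation_ring_subring P; move: h; rewrite inE. Qed.

Lemma vringB P z u :
  valuation_ring P z -> valuation_ring P u -> valuation_ring P (z - u).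
Proof.
have [_ h _] := valuation_ring_subring P => Oz Ou.
by move: (h z u); rewrite !inE; apply.
Qed.

Lemma vringM P z u :
  valuation_ring P z -> valuation_ring P u -> valuation_ring P (z * u).
Proof.
have [_ _ h] := valuation_ring_subring P => Oz Ou.
by move: (h z u); rewrite !inE; apply.
Qed.

Lemma vring0 P : valuation_ring P 0.
Proof. by rewrite -(subrr 1); apply: vringB; apply: vring1. Qed.

Lemma vringN P z : valuation_ring P z -> valuation_ring P (- z).
Proof. by move=> Oz; rewrite -sub0r; apply: vringB => //; apply: vring0. Qed.

Lemma vringD P z u :
  valuation_ring P z -> valuation_ring P u -> valuation_ring P (z + u).
Proof. by move=> Oz Ou; rewrite -[u]opprK; apply: vringB => //; apply: vringN. Qed.

Lemma vringX P z n : valuation_ring P z -> valuation_ring P (z ^+ n).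
Proof.
move=> Oz; elim: n => [|n IH]; first by rewrite expr0; apply: vring1.
by rewrite exprS; apply: vringM.
Qed.

Lemma vring_const P a : valuation_ring P (c a).
Proof. by have [h _] := valuation_ring_const P; apply: h; exists a. Qed.

Lemma vring_prod P (I : Type) (s : seq I) (E : I -> L) :
  (forall i, valuation_ring P (E i)) -> valuation_ring P (\prod_(i <- s) E i).
Proof.
move=> h; elim: s => [|i s IH]; first by rewrite big_nil; apply: vring1.
by rewrite big_cons; apply: vringM.
Qed.

Lemma unit_neq0 P u : valuation_units P u -> u != 0.
Proof. by case. Qed.

Lemma unit_vring P u : valuation_units P u -> valuation_ring P u.
Proof. by case. Qed.

Lemma unit1 P : valuation_units P 1.
Proof. by split; rewrite ?oner_neq0 ?invr1 //; apply: vring1. Qed.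

Lemma unitV P u : valuation_units P u -> valuation_units P u^-1.
Proof. by move=> [nz Ou OVu]; split; rewrite ?invr_eq0 ?invrK. Qed.

Lemma unitM P u w :
  valuation_units P u -> valuation_units P w -> valuation_units P (u * w).
Proof.
move=> [u0 Ou OVu] [w0 Ow OVw].
by split; rewrite ?mulf_neq0 // ?invfM; apply: vringM.
Qed.

Lemma unitX P u n : valuation_units P u -> valuation_units P (u ^+ n).
Proof.
move=> Uu; elim: n => [|n IH]; first by rewrite expr0; apply: unit1.
by rewrite exprS; apply: unitM.
Qed.

Lemma unit_const P a : a != 0 -> valuation_units P (c a).
Proof.
by move=> a0; split; rewrite ?fmorph_eq0 // -?fmorphV; apply: vring_const.
Qed.

Lemma notin_vringV P z : ~ valuation_ring P z -> maximal_ideal P z^-1.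
Proof.
move=> NOz; split; first by case: (valuation_ring_total P z).
by case=> _ _; rewrite invrK.
Qed.

Lemma ideal_vringN P z : z != 0 -> maximal_ideal P z -> ~ valuation_ring P z^-1.
Proof. by move=> z0 [Oz NU] OV; apply: NU; split. Qed.

Lemma vring_cases P z : valuation_ring P z ->
  maximal_ideal P z \/ valuation_units P z.
Proof. by move=> Oz; case: (pselect (valuation_units P z)) => U; [right|left]. Qed.

Lemma ideal0 P : maximal_ideal P 0.
Proof. by split; [apply: vring0 | case; rewrite eqxx]. Qed.

Lemma ideal_vring P z : maximal_ideal P z -> valuation_ring P z.
Proof. by case. Qed.

Lemma ideal_mull P z u :
  valuation_ring P z -> maximal_ideal P u -> maximal_ideal P (z * u).
Proof.
move=> Oz [Ou NU]; split; first exact: vringM.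
case=> zu0 _ OV; apply: NU; have u0 : u != 0.
  by apply: contra_neq zu0 => ->; rewrite mulr0.
split=> //; have -> : u^-1 = z * (z * u)^-1.
  rewrite invfM mulrA divff ?mul1r //.
  by apply: contra_neq zu0 => ->; rewrite mul0r.
exact: vringM.
Qed.

(** Of two nonunits one divides the other, so the nonunits are stable under
    sums. *)
Lemma idealD P z u :
  maximal_ideal P z -> maximal_ideal P u -> maximal_ideal P (z + u).
Proof.
move=> Mz Mu.
have [->|z0] := eqVneq z 0; first by rewrite add0r.
have [->|u0] := eqVneq u 0; first by rewrite addr0.
case: (valuation_ring_total P (z / u)) => h.
  have -> : z + u = (z / u + 1) * u by rewrite mulrDl mul1r divfK.
  by apply: ideal_mull => //; apply: vringD => //; apply: vring1.
have -> : z + u = ((z / u)^-1 + 1) * z.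
  by rewrite invfM invrK mulrDl mul1r mulrAC mulVf // mul1r addrC.
by apply: ideal_mull => //; apply: vringD => //; apply: vring1.
Qed.

Lemma idealN P z : maximal_ideal P z -> maximal_ideal P (- z).
Proof.
rewrite -mulN1r; apply: ideal_mull; apply: vringN; exact: vring1.
Qed.

Lemma unit_addM P u z :
  valuation_units P u -> maximal_ideal P z -> valuation_units P (u + z).
Proof.
move=> Uu Mz.
have [|M|//] := @vring_cases P (u + z).
  by apply: vringD; [apply: unit_vring | apply: ideal_vring].
have [_ []] : maximal_ideal P u; last by [].
by rewrite -(addrK z u); apply: idealD => //; apply: idealN.
Qed.

Lemma ideal_sum P (I : Type) (s : seq I) (Q : pred I) (E : I -> L) :
  (forall i, Q i -> maximal_ideal P (E i)) ->
  maximal_ideal P (\sum_(i <- s | Q i) E i).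
Proof.
by move=> h; apply: big_ind => //; [apply: ideal0 | move=> *; apply: idealD].
Qed.

Lemma ideal_prime P z u : valuation_ring P z -> valuation_ring P u ->
  maximal_ideal P (z * u) -> maximal_ideal P z \/ maximal_ideal P u.
Proof.
move=> /vring_cases[|Uz]; first by left.
move=> /vring_cases[|Uu]; first by right.
by case=> _ []; apply: unitM.
Qed.

Lemma ideal_prod P (I : eqType) (s : seq I) (E : I -> L) :
    (forall i, valuation_ring P (E i)) -> maximal_ideal P (\prod_(i <- s) E i) ->
  exists2 i, i \in s & maximal_ideal P (E i).
Proof.
move=> OE; elim: s => [|i s IH]; first by rewrite big_nil => -[_ []]; apply: unit1.
rewrite big_cons => /ideal_prime[||Mi|/IH[j js Mj]] //; first exact: vring_prod.
  by exists i; rewrite ?mem_head.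
by exists j; rewrite // inE js orbT.
Qed.

Lemma idealX P z n : maximal_ideal P z -> maximal_ideal P (z ^+ n.+1).
Proof.
by move=> Mz; rewrite exprSr; apply: ideal_mull => //; apply/vringX/ideal_vring.
Qed.

(** A valuation ring is integrally closed: were z outside it, the powers of its
    inverse would all be nonunits. *)
Lemma vring_root P z n : valuation_ring P (z ^+ n.+1) -> valuation_ring P z.
Proof.
move=> Ozn; case: (pselect (valuation_ring P z)) => // NOz.
have z0 : z != 0 by apply: contra_not_neq NOz => ->; apply: vring0.
have /ideal_vringN := @idealX P _ n (notin_vringV NOz).
by rewrite expf_neq0 ?invr_eq0 // exprVn invrK => /(_ isT) [].
Qed.

Lemma unit_root P z n : valuation_units P (z ^+ n.+1) -> valuation_units P z.
Proof.
move=> [zn0 O1 O2]; split; first by rewrite expf_eq0 in zn0.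
  exact: (vring_root O1).
by apply: (@vring_root P _ n); rewrite exprVn.
Qed.

Lemma ideal_root P z n : maximal_ideal P (z ^+ n.+1) -> maximal_ideal P z.
Proof.
move=> [/vring_root Oz NU]; split=> // U; apply: NU; exact: unitX.
Qed.

(** * Orders with respect to a nonunit *)

(** The valuation of z measured by t; t need not be a prime element yet, which
    is what allows primality to be deduced from the existence of orders. *)
Definition has_order P t z (n : int) : Prop :=
  exists2 u, valuation_units P u & z = t ^ n * u.

Lemma order_neq0 P t z n : t != 0 -> has_order P t z n -> z != 0.
Proof. by move=> t0 [u Uu ->]; rewrite mulf_neq0 ?expfz_neq0 ?(unit_neq0 Uu). Qed.

Lemma order_unit P t u : valuation_units P u -> has_order P t u 0.
Proof. by move=> Uu; exists u => //; rewrite expr0z mul1r. Qed.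

Lemma order_self P t : has_order P t t 1.
Proof. by exists 1; rewrite ?expr1z ?mulr1 //; apply: unit1. Qed.

Lemma orderM P t z z' n n' : t != 0 ->
  has_order P t z n -> has_order P t z' n' -> has_order P t (z * z') (n + n').
Proof.
move=> t0 [u Uu ->] [u' Uu' ->]; exists (u * u'); first exact: unitM.
by rewrite expfzDr // mulrACA.
Qed.

Lemma orderV P t z n : has_order P t z n -> has_order P t z^-1 (- n).
Proof.
move=> [u Uu ->]; exists u^-1; first exact: unitV.
by rewrite invfM invr_expz.
Qed.

Lemma orderX P t z n k : t != 0 ->
  has_order P t z n -> has_order P t (z ^+ k) (n * k%:Z).
Proof.
move=> t0 h; elim: k => [|k IH].
  by rewrite expr0 mulr0; apply: order_unit; apply: unit1.
by rewrite exprS intS mulrDr mulr1; apply: orderM.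
Qed.

Lemma orderXz P t z n (k : int) : t != 0 ->
  has_order P t z n -> has_order P t (z ^ k) (n * k).
Proof.
move=> t0 h; case: k => k; first exact: orderX.
by rewrite NegzE -invr_expz mulrN; apply/orderV/orderX.
Qed.

Lemma order0_unit P t z : has_order P t z 0 -> valuation_units P z.
Proof. by move=> [u Uu ->]; rewrite expr0z mul1r. Qed.

Lemma idealXz P t (n : int) : maximal_ideal P t -> 0 < n -> maximal_ideal P (t ^ n).
Proof. by case: n => // -[//|n] Mt _; apply: idealX. Qed.

Lemma order_ideal P t z n : maximal_ideal P t ->
  has_order P t z n -> 0 < n -> maximal_ideal P z.
Proof.
move=> Mt [u Uu ->] n0; rewrite mulrC; apply: ideal_mull; first exact: unit_vring.
exact: idealXz.
Qed.

Lemma order_vring P t z n : maximal_ideal P t ->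
  has_order P t z n -> 0 <= n -> valuation_ring P z.
Proof.
move=> Mt [u Uu ->]; rewrite le_eqVlt => /orP[/eqP<-|n0].
  by rewrite expr0z mul1r; apply: unit_vring.
by apply: ideal_vring; apply: (@order_ideal P t _ n) => //; exists u.
Qed.

Lemma vring_order P t z n : t != 0 -> maximal_ideal P t ->
  has_order P t z n -> valuation_ring P z -> 0 <= n.
Proof.
move=> t0 Mt h Oz; rewrite leNgt; apply/negP => n0.
have z0 := order_neq0 t0 h.
have /ideal_vringN : maximal_ideal P z^-1.
  by apply: (order_ideal Mt (orderV h)); rewrite oppr_gt0.
by rewrite invr_eq0 invrK => /(_ z0).
Qed.

Lemma order_inj P t z n n' : t != 0 -> maximal_ideal P t ->
  has_order P t z n -> has_order P t z n' -> n = n'.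
Proof.
have le k k' : t != 0 -> maximal_ideal P t ->
    has_order P t z k -> has_order P t z k' -> k' <= k.
  move=> t0 Mt h h'; rewrite -subr_ge0.
  apply: (vring_order t0 Mt (z := z / z)); first exact: orderM h (orderV h').
  by rewrite divff ?(order_neq0 t0 h) //; apply: vring1.
by move=> t0 Mt h h'; apply/eqP; rewrite eq_le !le.
Qed.

(** The strict triangle equality: a term of strictly smallest order dominates
    the sum. *)
Lemma order_sum P t (I : finType) (E : I -> L) (n : I -> int) (l : I) :
    t != 0 -> maximal_ideal P t ->
    (forall i, E i != 0 -> has_order P t (E i) (n i)) ->
    E l != 0 -> (forall i, i != l -> E i != 0 -> n l < n i) ->
  has_order P t (\sum_i E i) (n l).
Proof.
move=> t0 Mt hE El0 lmin; rewrite (bigD1 l) //=.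
have [u Uu ->] := hE l El0.
exists (u + t ^ (- n l) * \sum_(i | i != l) E i); last first.
  by rewrite mulrDr mulrA -expfzDr // subrr expr0z mul1r.
apply: unit_addM => //; rewrite big_distrr; apply: ideal_sum => i il /=.
have [->|Ei0] := eqVneq (E i) 0; first by rewrite mulr0; apply: ideal0.
have [w Uw ->] := hE i Ei0; rewrite mulrA -expfzDr // mulrC.
apply: ideal_mull; first exact: unit_vring.
by apply: idealXz => //; rewrite addrC subr_gt0 lmin.
Qed.

(** * Discrete places *)

Definition uniformizer P t : Prop :=
  [/\ t != 0, maximal_ideal P t & forall z, z != 0 -> exists n, has_order P t z n].

Lemma uniformizer_prime P t : uniformizer P t -> prime_element P t.
Proof.
case=> t0 Mt ordt; apply/seteqP; split=> [z Mz|_ [w Ow <-]] /=; last first.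
  by rewrite mulrC; apply: ideal_mull.
have [->|z0] := eqVneq z 0; first by exists 0; [apply: vring0 | rewrite mulr0].
have [n hz] := ordt z z0.
have n0 := vring_order t0 Mt hz (ideal_vring Mz).
exists (z / t); last by rewrite mulrC divfK.
apply: (order_vring Mt (orderM t0 hz (orderV (order_self P t)))).
have: n != 0.
  apply/eqP => n00; case: hz => u Uu; rewrite n00 expr0z mul1r => ez.
  by case: Mz => _; rewrite ez.
by lia.
Qed.

Lemma prime_element_neq0 P t : prime_element P t -> t != 0.
Proof.
move=> pt; apply/eqP => t0.
have [_ NL] := valuation_ring_proper P.
apply: NL => z _; case: (pselect (valuation_ring P z)) => // NOz.
have := notin_vringV NOz; rewrite pt t0 => -[w _]; rewrite mul0r => /esym/eqP.
by rewrite invr_eq0 => /eqP->; apply: vring0.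
Qed.

Lemma prime_element_ideal P t : prime_element P t -> maximal_ideal P t.
Proof. by move=> ->; exists 1; rewrite ?mulr1 //; apply: vring1. Qed.

(** Two prime elements are associates, so they give the same orders. *)
Lemma order_prime P t t' z n : prime_element P t -> prime_element P t' ->
  has_order P t' z n -> has_order P t z n.
Proof.
move=> pt pt' [u Uu ->].
have t0 := prime_element_neq0 pt; have t'0 := prime_element_neq0 pt'.
have Ut : valuation_units P (t' / t).
  split; first by rewrite mulf_neq0 ?invr_eq0.
    have := prime_element_ideal pt'; rewrite pt => -[w Ow <-].
    by rewrite mulrC mulKf.
  have := prime_element_ideal pt; rewrite {1}pt' => -[w Ow <-].
  by rewrite invfM invrK mulKf.
exists ((t' / t) ^ n * u); last first.
  by rewrite mulrA -expfzMl mulrCA divff // mulr1.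
apply: unitM => //; case: (n) => k; first exact: unitX.
by rewrite NegzE -invr_expz; apply/unitV/unitX.
Qed.

Lemma valuation_order P t z n :
  prime_element P t -> has_order P t z n -> valuation P z = n.
Proof.
move=> pt hz; rewrite /valuation; apply: xget_unique => [|n'].
  by case: hz => u Uu ez; exists t, u.
move=> [t' [u [pt' Uu ez]]].
apply: (order_inj (prime_element_neq0 pt) (prime_element_ideal pt)) _ hz.
by apply: (order_prime pt pt'); exists u.
Qed.

Lemma valuation_lt0 P z : valuation P z < 0 ->
  exists t n, [/\ prime_element P t, has_order P t z n & n < 0].
Proof.
rewrite /valuation; case: xgetP => [n _|_]; last by rewrite ltxx.
move=> [t [u [pt Uu ez]]] n0.
by exists t, n; split=> //; exists u.
Qed.

Lemma valuation_lt0_notin P z : valuation P z < 0 -> ~ valuation_ring P z.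
Proof.
move=> /valuation_lt0[t [n [pt hz n0]]] Oz.
have := vring_order (prime_element_neq0 pt) (prime_element_ideal pt) hz Oz.
by rewrite leNgt n0.
Qed.

Lemma vring_valuation P z : valuation_ring P z -> 0 <= valuation P z.
Proof.
by move=> Oz; rewrite leNgt; apply/negP => /valuation_lt0_notin.
Qed.

Lemma uniformizer_vring P t z :
  uniformizer P t -> 0 <= valuation P z -> valuation_ring P z.
Proof.
move=> ut; have [t0 Mt ordt] := ut.
have [->|z0] := eqVneq z 0; first by move=> _; apply: vring0.
have [n hz] := ordt z z0.
rewrite (valuation_order (uniformizer_prime ut) hz); exact: (order_vring Mt hz).
Qed.

Lemma place_ext P P' : valuation_ring P = valuation_ring P' -> P = P'.
Proof.
case: P P' => [O a b d e] [O' a' b' d' e'] /= E.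
move: a' b' d' e'; rewrite -E => a' b' d' e'.
by congr Place; apply: Prop_irrelevance.
Qed.

(** A discrete valuation ring is a maximal proper subring of its field: any
    further element would bring in the inverse of the uniformizer. *)
Lemma uniformizer_place_eq P P' t : uniformizer P t ->
    valuation_ring P `<=` valuation_ring P' -> maximal_ideal P' t ->
  P = P'.
Proof.
move=> [t0 Mt ordt] sub Mt'; apply: place_ext; apply/seteqP; split=> // z Oz.
have [->|z0] := eqVneq z 0; first exact: vring0.
have [n [u Uu ez]] := ordt z z0.
apply: (order_vring Mt (n := n)); first by exists u.
apply: (vring_order t0 Mt' (z := z)) => //; exists u => //.
by case: Uu => u0 /sub Ou /sub OVu; split.
Qed.

End ValuationRings.

(** * Functions on the curve *)

Lemma frac_clear (R : idomainType) (x : {fraction R}) :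
  exists n d : R, d != 0 /\ tofrac d * x = tofrac n.
Proof.
elim/quotW: x => x; exists \n_x, \d_x; split; first exact: denom_ratioP.
unlock tofrac; rewrite -[LHS]FracField.pi_mul; apply/eqmodP.
rewrite /= FracField.equivfE /FracField.mulf.
by rewrite !numden_Ratio ?mulf_neq0 ?oner_neq0 ?denom_ratioP // mul1r mulr1 mulrC.
Qed.

Section Curve.
Variables (K : closedFieldType) (F : fieldExtType (ratfun K)) (y : F).
Variables (m r : nat) (alpha : 'I_r -> K).
Implicit Types (P : place (ext_const F)) (g h d q : {poly K}).
Implicit Types (G H : {poly {poly K}}) (z : F).

Definition polyF : {rmorphism {poly K} -> F} :=
  GRing.in_alg F \o @tofrac {poly K}.

Definition evF : {rmorphism {poly {poly K}} -> F} :=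
  horner_eval y \o map_poly polyF.

Definition ev_at (a b : K) : {rmorphism {poly {poly K}} -> K} :=
  horner_eval a \o horner_eval b%:P.

Definition curve_poly : {poly K} := \prod_(i < r) ('X - (alpha i)%:P).

Notation xF := (polyF 'X).

Lemma polyF_const a : polyF a%:P = ext_const F a.
Proof. by rewrite /ext_const /polyF /=. Qed.

Lemma polyF_eq0 g : (polyF g == 0) = (g == 0).
Proof. by rewrite fmorph_eq0 tofrac_eq0. Qed.

Lemma polyF_alg g : (tofrac g)%:A = polyF g.
Proof. by []. Qed.

Opaque polyF.

Lemma xF_neq0 : xF != 0.
Proof. by rewrite polyF_eq0 polyX_eq0. Qed.

Lemma evFX : evF 'X = y.
Proof. by rewrite /evF /= map_polyX /horner_eval hornerX. Qed.

Lemma evFC g : evF g%:P = polyF g.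
Proof. by rewrite /evF /= map_polyC /horner_eval hornerC. Qed.

Lemma ev_atX a b : ev_at a b 'X = b.
Proof. by rewrite /ev_at /= /horner_eval hornerX hornerC. Qed.

Lemma ev_atC a b g : ev_at a b g%:P = g.[a].
Proof. by rewrite /ev_at /= /horner_eval hornerC. Qed.

Lemma evF_sum G : (size G <= m)%N -> evF G = \sum_(i < m) polyF G`_i * y ^+ i.
Proof.
move=> sG; rewrite /evF /= /horner_eval (@horner_coef_wide _ m).
  by apply: eq_bigr => i _; rewrite coef_map.
by rewrite (leq_trans (size_poly _ _)).
Qed.

Lemma vring_polyF P g : valuation_ring P xF -> valuation_ring P (polyF g).
Proof.
move=> Ox; elim/poly_ind: g => [|g a IH]; first by rewrite rmorph0; apply: vring0.
rewrite rmorphD rmorphM; apply: vringD; first exact: vringM.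
by rewrite polyF_const; apply: vring_const.
Qed.

(** Where x takes the value a, the polynomial g takes the value g(a). *)
Lemma polyF_ideal P a g : maximal_ideal P (polyF ('X - a%:P)) ->
  maximal_ideal P (polyF g - ext_const F g.[a]).
Proof.
move=> Ma; have Ox : valuation_ring P xF.
  have -> : 'X = ('X - a%:P) + a%:P by rewrite subrK.
  rewrite rmorphD polyF_const; apply: vringD; first exact: ideal_vring.
  exact: vring_const.
have /factor_theorem[q eq] : root (g - g.[a]%:P) a by rewrite /root !hornerE subrr.
rewrite -polyF_const -rmorphB eq rmorphM.
by apply: ideal_mull => //; apply: vring_polyF.
Qed.

Lemma polyF_unit P a g : maximal_ideal P (polyF ('X - a%:P)) -> g.[a] != 0 ->
  valuation_units P (polyF g).
Proof.
move=> Ma ga; rewrite -(subrK (ext_const F g.[a]) (polyF g)) addrC.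
by apply: unit_addM; [apply: unit_const | apply: polyF_ideal].
Qed.

(** Near a pole of x a polynomial behaves like its leading monomial. *)
Lemma polyF_order_pole P t (e : int) g : t != 0 -> maximal_ideal P t -> 0 < e ->
    has_order P t xF (- e) -> g != 0 ->
  has_order P t (polyF g) (- (e * (size g).-1%:Z)).
Proof.
move=> t0 Mt e0 hx g0.
have sg : (0 < size g)%N by rewrite size_poly_gt0.
have lt : ((size g).-1 < size g)%N by lia.
rewrite -[in polyF g](coefK g) poly_def rmorph_sum.
pose n (i : 'I_(size g)) : int := - (e * i%:Z).
rewrite -[- (e * _)]/(n (Ordinal lt)); apply: order_sum => // [i||i].
- rewrite -mul_polyC rmorphM rmorphXn mulf_eq0 negb_or polyF_const => /andP[gi _].
  rewrite /n -[- _]add0r -mulNr; apply: orderM => //; last exact: orderX.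
  by apply/order_unit/unit_const; rewrite fmorph_eq0 in gi.
- rewrite polyF_eq0 -mul_polyC mulf_neq0 ?polyC_eq0 ?expf_neq0 ?polyX_eq0 //.
  by rewrite -[_`__]/(lead_coef g) lead_coef_eq0.
- move=> il _; have := ltn_ord i; have : nat_of_ord i != (size g).-1 by [].
  rewrite /n /= ltrN2 ltr_pM2l //; lia.
Qed.

(** Distinctness of the orders n makes one term of G(x, y) strictly dominant;
    which one depends on n only, not on a place. *)
Lemma min_term G (n : 'I_m -> int) : (size G <= m)%N -> G != 0 -> injective n ->
  exists2 l : 'I_m, G`_l != 0 & forall i : 'I_m, i != l -> G`_i != 0 -> n l < n i.
Proof.
move=> sG G0 ninj; have sG0 : (0 < size G)%N by rewrite size_poly_gt0.
have lt : ((size G).-1 < m)%N by lia.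
have top : G`_(Ordinal lt) != 0 by rewrite -[_`__]/(lead_coef G) lead_coef_eq0.
case: (@arg_minP _ _ _ _ (fun i : 'I_m => G`_i != 0) n top) => l Gl lmin.
exists l => // i il Gi; rewrite lt_neqAle lmin // andbT.
by apply: contra_neq il => /ninj.
Qed.

Lemma evF_order P t G (n : 'I_m -> int) (l : 'I_m) :
    t != 0 -> maximal_ideal P t -> (size G <= m)%N ->
    (forall i : 'I_m, G`_i != 0 -> has_order P t (polyF G`_i * y ^+ i) (n i)) ->
    G`_l != 0 ->
    (forall i : 'I_m, i != l -> G`_i != 0 -> n l < n i) ->
  has_order P t (evF G) (n l).
Proof.
move=> t0 Mt sG hG Gl lmin; rewrite evF_sum //.
have nz (i : 'I_m) : polyF G`_i * y ^+ i != 0 -> G`_i != 0.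
  by rewrite mulf_eq0 negb_or polyF_eq0 => /andP[].
apply: order_sum => // [i /nz /hG //||i il /nz]; last exact: lmin.
exact: order_neq0 (hG l Gl).
Qed.

Hypothesis m_gt0 : (0 < m)%N.
Hypothesis co_mr : coprime m r.
Hypothesis y_eq : y ^+ m = polyF curve_poly.
Hypothesis F_gen : <<1; y>>%VS = fullv.

Lemma curve_poly_monic : curve_poly \is monic.
Proof. exact: monic_prod_XsubC. Qed.

Lemma curve_poly_neq0 : curve_poly != 0.
Proof. exact: monic_neq0 curve_poly_monic. Qed.

Lemma size_curve_poly : size curve_poly = r.+1.
Proof. by rewrite size_prod_XsubC [index_enum _]unlock -enumT size_enum_ord. Qed.

Lemma y_neq0 : y != 0.
Proof.
apply/eqP => y0; move: y_eq; rewrite y0 expr0n gtn_eqF // => /esym/eqP.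
by rewrite polyF_eq0 (negPf curve_poly_neq0).
Qed.

(** * The place at infinity *)

(** The order of g_i(x) y^i at infinity, where x has order - m and y has order
    - r. *)
Definition pole_order_at_infinity G (i : 'I_m) : int :=
  - (m%:Z * (size G`_i).-1%:Z) + - r%:Z * i%:Z.

(** Modulo m the order is - r i, and r is invertible modulo m. *)
Lemma pole_order_inj G : injective (pole_order_at_infinity G).
Proof.
move=> i j /eqP; rewrite /pole_order_at_infinity => e.
apply: val_inj; wlog ij : i j e / (i <= j)%N => [h|] /=.
  case/orP: (leq_total i j) => [|ji]; first exact: h.
  by symmetry; apply: h; rewrite // eq_sym.
have : (m %| r * (j - i))%N.
  have : (m%:Z %| r%:Z * (j%:Z - i%:Z))%Z.
    by apply/dvdzP; exists ((size G`_i).-1%:Z - (size G`_j).-1%:Z); nia.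
  by rewrite /dvdz subzn // abszM.
rewrite Gauss_dvdr // => /dvdn_leq; have := ltn_ord j; lia.
Qed.

(** The valuation at infinity is totally ramified: with m A + r B = 1 the
    function x^(-A) y^(-B) is a uniformizer for every place where x has a pole. *)
Lemma pole_uniformizer : exists2 t : F, t != 0 &
  forall P, ~ valuation_ring P xF ->
    [/\ maximal_ideal P t, has_order P t xF (- m%:Z) & has_order P t y (- r%:Z)].
Proof.
have /coprimezP[[A B] /= AB] : coprimez m%:Z r%:Z by [].
set t := xF ^ (- A) * y ^ (- B).
have t0 : t != 0 by rewrite mulf_neq0 // expfz_neq0 ?xF_neq0 ?y_neq0.
exists t => // P NOx.
have Mx := notin_vringV NOx.
have x0 := xF_neq0; have y0 := y_neq0.
have xV0 : xF^-1 != 0 by rewrite invr_eq0.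
have hx : has_order P xF^-1 xF (- 1).
  by have := orderV (order_self P xF^-1); rewrite invrK.
have hf := polyF_order_pole xV0 Mx ltr01 hx curve_poly_neq0.
rewrite size_curve_poly -y_eq mul1r /= in hf.
(* Here orders are measured by 1 / x, in which t^m has order m A + r B = 1. *)
have htm : has_order P xF^-1 (t ^+ m) 1.
  rewrite exprMn exprnP exprzAC -exprnP [(y ^ _) ^+ m]exprnP exprzAC -exprnP.
  have e1 : - 1 * m%:Z * - A + - r%:Z * - B = 1 by rewrite -[RHS]AB; ring.
  rewrite -[X in has_order _ _ _ X]e1.
  by apply: orderM => //; apply: orderXz => //; apply: orderX.
have Mt : maximal_ideal P t.
  have := order_ideal Mx htm ltr01.
  by rewrite -(prednK m_gt0); apply: ideal_root.
split=> //.
  have [w Uw ew] := htm; exists w => //.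
  by rewrite -exprnN ew expr1z invfM invrK divfK ?(unit_neq0 Uw).
exists (y * t ^+ r); last by rewrite -exprnN mulrCA mulVf ?expf_neq0 // mulr1.
apply: (@unit_root _ _ _ _ _ m.-1); rewrite prednK // exprMn exprAC.
apply: (@order0_unit _ _ _ _ xF^-1).
have e0 : - r%:Z + 1 * r%:Z = 0 by ring.
rewrite -[X in has_order _ _ _ X]e0.
by apply: orderM => //; apply: orderX.
Qed.

Definition pole_parameter (t : F) : Prop :=
  t != 0 /\ forall P, ~ valuation_ring P xF ->
    [/\ maximal_ideal P t, has_order P t xF (- m%:Z) & has_order P t y (- r%:Z)].

(** The dominant term at infinity is found from the degrees of the coefficients,
    before any place is chosen; that is what makes the place unique. *)
Lemma evF_order_pole t G : pole_parameter t -> (size G <= m)%N -> G != 0 ->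
  exists l : 'I_m,
    (forall i : 'I_m, G`_i != 0 ->
       pole_order_at_infinity G l <= pole_order_at_infinity G i) /\
    (forall P, ~ valuation_ring P xF ->
       has_order P t (evF G) (pole_order_at_infinity G l)).
Proof.
move=> [t0 ht] sG G0; have [l Gl lmin] := min_term sG G0 (@pole_order_inj G).
exists l; split=> [i Gi|P /ht[Mt hx hy]].
  by have [->//|il] := eqVneq i l; apply/ltW/lmin.
apply: evF_order => // i Gi; apply: orderM => //; last exact: orderX.
exact: polyF_order_pole.
Qed.

Definition reduced G : {poly {poly K}} :=
  Pdiv.Ring.rmodp G ('X^m - curve_poly%:P).

Lemma curve_eq_monic : 'X^m - curve_poly%:P \is monic.
Proof. exact: monicXnsubC. Qed.

Lemma size_reduced G : (size (reduced G) <= m)%N.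
Proof.
have := Pdiv.Ring.ltn_rmodp G ('X^m - curve_poly%:P).
by rewrite monic_neq0 ?curve_eq_monic // size_XnsubC.
Qed.

Lemma evF_reduced G : evF (reduced G) = evF G.
Proof.
rewrite [in RHS](Pdiv.RingMonic.rdivp_eq curve_eq_monic G) rmorphD rmorphM rmorphB.
by rewrite rmorphXn evFX evFC y_eq subrr mulr0 add0r.
Qed.

Lemma ev_at_reduced a b G : b ^+ m = curve_poly.[a] ->
  ev_at a b (reduced G) = ev_at a b G.
Proof.
move=> ab; rewrite [in RHS](Pdiv.RingMonic.rdivp_eq curve_eq_monic G).
by rewrite rmorphD rmorphM rmorphB rmorphXn ev_atX ev_atC ab subrr mulr0 add0r.
Qed.

Lemma polyF_clear (k : ratfun K) :
  exists n d : {poly K}, d != 0 /\ polyF d * k%:A = polyF n.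
Proof.
have [n [d [d0 e]]] := frac_clear k; exists n, d; split=> //.
transitivity (GRing.in_alg F (tofrac d * k)); last by rewrite e.
exact/esym/(rmorphM (GRing.in_alg F)).
Qed.

(** Since y generates F over K(x), every function is a polynomial in x and y
    over a polynomial in x. *)
Lemma clear_denominators z :
  exists d G, [/\ d != 0, (size G <= m)%N & polyF d * z = evF G].
Proof.
suff [d [G [d0 e]]] : exists d G, d != 0 /\ polyF d * z = evF G.
  by exists d, (reduced G); rewrite size_reduced evF_reduced.
have /Fadjoin_polyP[p /polyOverP p1 ->] : z \in <<1; y>>%VS by rewrite F_gen memvf.
rewrite horner_coef; elim/big_ind: _ => [|z1 z2|i _].
- by exists 1, 0; rewrite oner_neq0 !rmorph0 mulr0.
- move=> [d1 [G1 [d10 e1]]] [d2 [G2 [d20 e2]]].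
  exists (d1 * d2), (d2%:P * G1 + d1%:P * G2); split; first exact: mulf_neq0.
  by rewrite rmorphD !rmorphM !evFC -e1 -e2; ring.
have /vlineP[k ->] := p1 i; have [n [d [d0 e]]] := polyF_clear k.
exists d, (n%:P * 'X^i); split=> //.
rewrite rmorphM rmorphXn evFX evFC mulrA; congr (_ * _).
exact: e.
Qed.

Variable Qinf : place (ext_const F).
Hypothesis Qinf_pole : ~ valuation_ring Qinf xF.

(** The powers of y below the m-th are linearly independent over K(x), because
    their orders at infinity are distinct modulo m. *)
Lemma evF_inj0 G : (size G <= m)%N -> evF G = 0 -> G = 0.
Proof.
move=> sG eG; have [//|G0] := eqVneq G 0.
have [t t0 ht] := pole_uniformizer.
have [l [_ /(_ _ Qinf_pole)]] := evF_order_pole (conj t0 ht) sG G0.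
by move=> /(order_neq0 t0); rewrite eG eqxx.
Qed.

(** A polynomial relation between the functions x and y is a multiple of the
    equation of the curve, hence holds at every point of the curve. *)
Lemma ev_at_evF0 a b G : b ^+ m = curve_poly.[a] -> evF G = 0 -> ev_at a b G = 0.
Proof.
move=> ab; rewrite -evF_reduced -(ev_at_reduced _ ab) => eG.
by rewrite (evF_inj0 (size_reduced G) eG) rmorph0.
Qed.

Lemma ev_at_neq0 a b G :
  b ^+ m = curve_poly.[a] -> ev_at a b G != 0 -> evF G != 0.
Proof. by move=> ab; apply: contra_neq; apply: ev_at_evF0. Qed.

Lemma pole_order_exists t z : pole_parameter t -> z != 0 ->
  exists n, forall P, ~ valuation_ring P xF -> has_order P t z n.
Proof.
move=> ht z0; have [d [G [d0 sG e]]] := clear_denominators z.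
have G0 : G != 0.
  apply: contra_neq z0 => G0; move/eqP: e.
  by rewrite G0 rmorph0 mulf_eq0 polyF_eq0 (negPf d0) => /eqP.
have [l [_ hG]] := evF_order_pole ht sG G0; case: (ht) => t0 hP.
exists (pole_order_at_infinity G l - - (m%:Z * (size d).-1%:Z)) => P NOx.
have [Mt hx _] := hP P NOx.
have -> : z = evF G / polyF d by rewrite -e mulrC mulKf ?polyF_eq0.
by apply: orderM; [|exact: hG|apply/orderV/polyF_order_pole].
Qed.

Lemma pole_place_uniformizer P t :
  pole_parameter t -> ~ valuation_ring P xF -> uniformizer P t.
Proof.
move=> ht NOx; have [t0 /(_ P NOx)[Mt _ _]] := ht; split=> // z z0.
by have [n hn] := pole_order_exists ht z0; exists n; apply: hn.
Qed.

(** Orders at a pole of x are computed from coefficients alone, hence do not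
    depend on the place. *)
Lemma pole_place_unique P P' :
  ~ valuation_ring P xF -> ~ valuation_ring P' xF -> P = P'.
Proof.
move=> NOx NOx'; have [t t0 ht] := pole_uniformizer.
have pt : pole_parameter t by split.
have [Mt _ _] := ht P NOx; have [Mt' _ _] := ht P' NOx'.
apply: (uniformizer_place_eq (pole_place_uniformizer pt NOx)) => // z Oz.
have [->|z0] := eqVneq z 0; first exact: vring0.
have [n hn] := pole_order_exists pt z0.
apply: (order_vring Mt' (hn P' NOx')).
exact: (vring_order t0 Mt (hn P NOx)).
Qed.

(** Otherwise y would be in K(x), against the independence of 1 and y. *)
Lemma dim_gt1 : (2 <= m)%N -> (2 <= \dim {:F})%N.
Proof.
move=> m2; rewrite ltnNge; apply/negP => le1.
have : y \in 1%VS.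
  suff -> : (1%VS : {vspace F}) = fullv by rewrite memvf.
  by apply/eqP; rewrite eqEdim subvf dimv1.
move=> /vlineP[k ek]; have [n [d [d0 e]]] := polyF_clear k.
set G := d%:P * 'X - n%:P.
have eG : evF G = 0 by rewrite rmorphB rmorphM evFX !evFC ek e subrr.
have sG : (size G <= m)%N.
  apply: leq_trans m2; apply: (leq_trans (size_polyD _ _)).
  rewrite geq_max size_polyN (leq_trans (size_polyC_leq1 _)) // andbT.
  rewrite (leq_trans (size_polyMleq _ _)) // size_polyX addn2.
  exact: size_polyC_leq1.
have := congr1 (fun H => H`_1) (evF_inj0 sG eG).
by rewrite coefB coefMX !coefC /= subr0 ?coef0 => /eqP; rewrite (negPf d0).
Qed.

Lemma vring_evF P G :
  valuation_ring P xF -> valuation_ring P y -> valuation_ring P (evF G).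
Proof.
move=> Ox Oy; elim/poly_ind: G => [|G g IH].
  by rewrite rmorph0; apply: vring0.
rewrite rmorphD rmorphM evFX evFC; apply: vringD; first exact: vringM.
exact: vring_polyF.
Qed.

Lemma vring_shift P z k : maximal_ideal P (z - ext_const F k) -> valuation_ring P z.
Proof.
move=> Mz; rewrite -(subrK (ext_const F k) z).
by apply: vringD; [apply: ideal_vring | apply: vring_const].
Qed.

(** * Affine points *)

Section Point.
Variables (a b : K).
Hypothesis ab : b ^+ m = curve_poly.[a].

(** The denominator H is normalized to take the value 1, so that the value of the
    quotient is that of the numerator G. *)
Definition has_value z (k : K) : Prop :=
  exists G H, [/\ ev_at a b H = 1, z * evF H = evF G & ev_at a b G = k].

Lemma value_evF G : has_value (evF G) (ev_at a b G).
Proof. by exists G, 1; rewrite !rmorph1 mulr1. Qed.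

Lemma value_polyF g : has_value (polyF g) g.[a].
Proof. by have := value_evF g%:P; rewrite evFC ev_atC. Qed.

Lemma value_y : has_value y b.
Proof. by have := value_evF 'X; rewrite evFX ev_atX. Qed.

Lemma value_const k : has_value (ext_const F k) k.
Proof. by have := value_polyF k%:P; rewrite hornerC polyF_const. Qed.

Lemma valueD z k z' k' :
  has_value z k -> has_value z' k' -> has_value (z + z') (k + k').
Proof.
move=> [G [H [e1 e2 <-]]] [G' [H' [e1' e2' <-]]].
exists (G * H' + G' * H), (H * H'); split; first by rewrite rmorphM e1 e1' mulr1.
  by rewrite rmorphD !rmorphM -e2 -e2'; ring.
by rewrite rmorphD !rmorphM e1 e1' !mulr1.
Qed.

Lemma valueM z k z' k' :
  has_value z k -> has_value z' k' -> has_value (z * z') (k * k').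
Proof.
move=> [G [H [e1 e2 <-]]] [G' [H' [e1' e2' <-]]].
exists (G * G'), (H * H'); rewrite !rmorphM e1 e1' mulr1; split=> //.
by rewrite -e2 -e2'; ring.
Qed.

Lemma valueB z k z' k' :
  has_value z k -> has_value z' k' -> has_value (z - z') (k - k').
Proof.
move=> hz hz'; rewrite -(mulN1r z') -(mulN1r k'); apply: valueD => //.
apply: valueM => //; have := value_const (-1).
by rewrite rmorphN rmorph1.
Qed.

Lemma value_inj z k k' : has_value z k -> has_value z k' -> k = k'.
Proof.
move=> [G [H [e1 e2 <-]]] [G' [H' [e1' e2' <-]]].
have /(ev_at_evF0 ab) : evF (G * H' - G' * H) = 0.
  by rewrite rmorphB !rmorphM -e2 -e2'; ring.
by rewrite rmorphB !rmorphM e1 e1' !mulr1 => /eqP; rewrite subr_eq0 => /eqP.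
Qed.

Lemma value1 : has_value 1 1.
Proof. by have := value_const 1; rewrite rmorph1. Qed.

Lemma value0 : has_value 0 0.
Proof. by have := value_const 0; rewrite rmorph0. Qed.

Lemma value_neq0 z k : has_value z k -> k != 0 -> z != 0.
Proof.
by move=> hz; apply: contra_neq => z0; move: hz; rewrite z0 => /(value_inj value0).
Qed.

Lemma valueV z k : has_value z k -> k != 0 -> has_value z^-1 k^-1.
Proof.
move=> hz k0; have z0 := value_neq0 hz k0.
case: hz => [G [H [e1 e2 e3]]].
pose C : {poly {poly K}} := (k^-1)%:P%:P.
exists (C * H), (C * G); rewrite !rmorphM /C !ev_atC !hornerC e1 e3 mulVf // mulr1.
by split=> //; rewrite -e2 mulrCA mulKf.
Qed.

Lemma valueX z k n : has_value z k -> has_value (z ^+ n) (k ^+ n).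
Proof.
by move=> hz; elim: n => [|n IH]; [exact: value1 | rewrite !exprS; apply: valueM].
Qed.

Definition value_unit u : Prop := exists2 k, k != 0 & has_value u k.

Lemma value_unitM u w : value_unit u -> value_unit w -> value_unit (u * w).
Proof.
move=> [k k0 hu] [k' k0' hw].
by exists (k * k'); [apply: mulf_neq0 | apply: valueM].
Qed.

Lemma value_unitV u : value_unit u -> value_unit u^-1.
Proof. by move=> [k k0 hu]; exists k^-1; rewrite ?invr_eq0 //; apply: valueV. Qed.

Lemma value_unitX u n : value_unit u -> value_unit (u ^+ n).
Proof.
by move=> [k k0 hu]; exists (k ^+ n); rewrite ?expf_neq0 //; apply: valueX.
Qed.

Lemma value_unit_neq0 u : value_unit u -> u != 0.
Proof. by move=> [k k0 hu]; apply: value_neq0 hu k0. Qed.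

(** t generates the maximal ideal of the local ring at (a, b), and the divisor
    of x - a is e times the point locally. *)
Definition local_parameter t (e : nat) : Prop :=
  [/\ has_value t 0,
      exists2 u, value_unit u & polyF ('X - a%:P) = t ^+ e * u
    & forall z, has_value z 0 -> exists w k, has_value w k /\ z = t * w].

(** The maximal ideal is generated by x - a and y - b in any case. *)
Lemma local_parameter_sufficient t e : (0 < e)%N ->
    has_value t 0 ->
    (exists2 u, value_unit u & polyF ('X - a%:P) = t ^+ e * u) ->
    (exists w k, has_value w k /\ y - ext_const F b = t * w) ->
  local_parameter t e.
Proof.
move=> e0 ht hx [wy [ky [hwy ey]]]; split=> // z [G [H [H1 ez G0]]].
have [u [ku ku0 hu] ex] := hx.
have HF : evF H != 0 by apply: (ev_at_neq0 (b := b) ab); rewrite H1 oner_neq0.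
have hH : has_value (evF H)^-1 1.
  by have := valueV (value_evF H); rewrite H1 invr1; apply; apply: oner_neq0.
have /factor_theorem[G1 eG1] : root (G - G.[b%:P]%:P) b%:P.
  by rewrite /root !hornerE subrr.
have /factor_theorem[g1 eg1] : root G.[b%:P] a by apply/eqP.
have eG : G = G1 * ('X - b%:P%:P) + (g1 * ('X - a%:P))%:P.
  by rewrite -eG1 -eg1 subrK.
have hG1 := value_evF G1; have hg1 := value_polyF g1.
have ht' := valueX e.-1 ht.
have hw := valueM (valueD (valueM hG1 hwy) (valueM hg1 (valueM ht' hu))) hH.
eexists; eexists; split; first exact: hw.
rewrite -[z](mulfK HF) ez eG rmorphD rmorphM rmorphB evFX !evFC.
rewrite rmorphM ex -(prednK e0) exprS polyF_const ey.
by ring.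
Qed.

(** Where y does not vanish, y^m - b^m = f(x) - f(a) vanishes to the same order
    as y - b, since m is prime to the characteristic. *)
Lemma unramified_parameter : m%:R != 0 :> K -> b != 0 ->
  local_parameter (polyF ('X - a%:P)) 1.
Proof.
move=> mK b0; apply: local_parameter_sufficient => //.
- by have := value_polyF ('X - a%:P); rewrite !hornerE subrr.
- exists 1; last by rewrite expr1 mulr1.
  by exists 1; [apply: oner_neq0 | apply: value1].
have /factor_theorem[g eg] : root (curve_poly - curve_poly.[a]%:P) a.
  by rewrite /root !hornerE subrr.
(* U is the cofactor of y - b in y^m - b^m; its value at the point is
   m b^(m-1). *)
pose U : {poly {poly K}} := \sum_(i < m) 'X ^+ (m.-1 - i) * b%:P%:P ^+ i.
have hU : ev_at a b U = m%:R * b ^+ m.-1.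
  rewrite rmorph_sum (eq_bigr (fun=> b ^+ m.-1)) => [|i _].
    by rewrite sumr_const card_ord mulr_natl.
  rewrite rmorphM !rmorphXn ev_atX ev_atC hornerC -exprD subnK //.
  by have := ltn_ord i; lia.
have U0 : ev_at a b U != 0 by rewrite hU mulf_neq0 ?expf_neq0.
exists (polyF g * (evF U)^-1), (g.[a] * (ev_at a b U)^-1); split.
  by apply: valueM; [apply: value_polyF | apply: valueV U0; apply: value_evF].
have UF := ev_at_neq0 ab U0.
apply: (mulIf UF); rewrite -!mulrA mulVf // mulr1 -rmorphM mulrC.
rewrite mulrC [in RHS]mulrC -eg rmorphB -y_eq -ab.
rewrite polyC_exp rmorphXn polyF_const subrXX; congr (_ * _).
rewrite rmorph_sum; apply: eq_bigr => i _.
by rewrite rmorphM !rmorphXn evFX evFC polyF_const.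
Qed.

(** The alpha_i are distinct, so a is a simple root of f and y^m = f(x) is a unit
    times x - a. *)
Lemma ramified_parameter : b = 0 -> injective alpha -> local_parameter y m.
Proof.
move=> b0 ainj.
have hy : has_value y 0 by have := value_y; rewrite b0.
apply: local_parameter_sufficient => //; last first.
  by exists 1, 1; rewrite b0 rmorph0 subr0 mulr1; split=> //; apply: value1.
have : root curve_poly a by rewrite /root -ab b0 expr0n gtn_eqF.
rewrite /root horner_prod => /prodf_eq0[i _]; rewrite !hornerE subr_eq0 => /eqP ai.
pose g := \prod_(j < r | j != i) ('X - (alpha j)%:P).
have eg : curve_poly = ('X - a%:P) * g by rewrite /curve_poly (bigD1 i) //= ai.
have ga : g.[a] != 0.
  rewrite horner_prod; apply/prodf_neq0 => j ji.
  by rewrite !hornerE subr_eq0 ai (inj_eq ainj) eq_sym.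
have hg : value_unit (polyF g) by exists g.[a] => //; apply: value_polyF.
exists (polyF g)^-1; first exact: value_unitV.
by rewrite y_eq eg rmorphM mulfK // (value_unit_neq0 hg).
Qed.

Lemma parameter_neq0 t e : (0 < e)%N -> local_parameter t e -> t != 0.
Proof.
move=> e0 [_ [u Uu ex] _]; apply/eqP => t0; move/eqP: ex.
by rewrite t0 expr0n gtn_eqF // mul0r polyF_eq0 polyXsubC_eq0.
Qed.

(** A factor of t^k times a unit is itself a power of t times a unit: dividing
    by t as long as the value is zero takes at most k steps. *)
Lemma value_order_factor t e k z w u : (0 < e)%N -> local_parameter t e ->
    (exists c, has_value z c) -> (exists c, has_value w c) -> value_unit u ->
    z * w = t ^+ k * u ->
  exists n, exists2 v, value_unit v & z = t ^+ n * v.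
Proof.
move=> e0 tpar; have t0 := parameter_neq0 e0 tpar; case: tpar => ht hx hM.
move=> [c hz] [c' hw] Uu; elim: k z c hz => [|k IH] z c hz ezw.
all: have [c0|c0] := eqVneq c 0; last by exists 0%N, z; rewrite ?mul1r //; exists c.
  have [d d0] := Uu; rewrite expr0 mul1r in ezw; rewrite -ezw.
  by move=> /value_inj/(_ (valueM hz hw)) ed; rewrite ed c0 mul0r eqxx in d0.
rewrite c0 in hz; have [z' [c1 [hz' ez]]] := hM z hz.
have [|n [v Uv ez']] := IH z' c1 hz'.
  by apply: (mulfI t0); rewrite mulrA -ez ezw exprS mulrA.
by exists n.+1, v; rewrite // ez ez' exprS mulrA.
Qed.

Lemma value_order_polyF t e d : local_parameter t e -> d != 0 ->
  exists n, exists2 v, value_unit v & polyF d = t ^+ n * v.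
Proof.
move=> [_ [u Uu ex] _] d0.
have [k [q]] := multiplicity_XsubC d a; rewrite d0 implyTb => qa ->.
exists (e * k)%N; exists (polyF q * u ^+ k).
  apply: value_unitM; last exact: value_unitX.
  by exists q.[a] => //; apply: value_polyF.
by rewrite rmorphM rmorphXn ex exprMn -exprM mulrCA mulrA.
Qed.

Lemma value_order_exists t e z : (0 < e)%N -> local_parameter t e -> z != 0 ->
  exists n : int, exists2 v, value_unit v & z = t ^ n * v.
Proof.
move=> e0 tpar z0; have t0 := parameter_neq0 e0 tpar.
(* A nonzero polynomial in x and y divides, among such polynomials, one in x
   alone, because its inverse is a quotient of the same kind. *)
have order_evF G : evF G != 0 ->
    exists n, exists2 v, value_unit v & evF G = t ^+ n * v.
  move=> G0; have [d [B [d0 _ eB]]] := clear_denominators (evF G)^-1.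
  have [k [u Uu ed]] := value_order_polyF tpar d0.
  have has_val H : exists c, has_value (evF H) c by eexists; apply: value_evF.
  have ezw : evF G * evF B = t ^+ k * u.
    by rewrite -eB -ed mulrCA divff // mulr1.
  exact: value_order_factor e0 tpar (has_val G) (has_val B) Uu ezw.
have [d [G [d0 _ eG]]] := clear_denominators z.
have dF : polyF d != 0 by rewrite polyF_eq0.
have [|n [v Uv en]] := order_evF G; first by rewrite -eG mulf_neq0.
have [k [u Uu ed]] := value_order_polyF tpar d0.
exists (n%:Z - k%:Z), (v / u); first by apply/value_unitM/value_unitV.
rewrite expfzDr // -exprnN -exprnP mulrACA -invfM -en -ed -eG.
by rewrite mulrAC divff // mul1r.
Qed.

Definition local_ring : set F := [set z | exists k, has_value z k].

Lemma local_ring_subring : subring_closed [in local_ring].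
Proof.
split=> [|z w|z w]; rewrite ?inE; first by exists 1; apply: value1.
  by move=> [k hz] [l hw]; exists (k - l); apply: valueB.
by move=> [k hz] [l hw]; exists (k * l); apply: valueM.
Qed.

Lemma local_ring_const : range (ext_const F) `<` local_ring.
Proof.
split=> [_ [k _ <-]|sub]; first by exists k; apply: value_const.
have /sub[k _] : local_ring xF by exists a; have := value_polyF 'X; rewrite hornerX.
rewrite -polyF_const => /eqP; rewrite -subr_eq0 -rmorphB polyF_eq0 -opprB oppr_eq0.
by rewrite polyXsubC_eq0.
Qed.

Lemma local_ring_proper : local_ring `<` [set: F].
Proof.
split=> // sub; pose t := polyF ('X - a%:P).
have ht : has_value t 0 by have := value_polyF ('X - a%:P); rewrite !hornerE subrr.
have [k hk] := sub t^-1 I; have := valueM ht hk.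
rewrite mul0r divff ?polyF_eq0 ?polyXsubC_eq0 // => /(value_inj value1) /eqP.
by rewrite oner_eq0.
Qed.

Lemma local_ring_total t e : (0 < e)%N -> local_parameter t e ->
  forall z, local_ring z \/ local_ring z^-1.
Proof.
move=> e0 tpar z; have [->|z0] := eqVneq z 0.
  by left; exists 0; apply: value0.
have [n [v Uv ->]] := value_order_exists e0 tpar z0; have [ht _ _] := tpar.
have [k k0 hv] := Uv; have [k' k0' hv'] := value_unitV Uv.
case: n => n; [left; exists (0 ^+ n * k) | right; exists (0 ^+ n.+1 * k')].
  by apply: valueM => //; apply: valueX.
rewrite invfM NegzE invr_expz opprK.
by apply: valueM => //; apply: valueX.
Qed.

Lemma point_place_exists t e : (0 < e)%N -> local_parameter t e ->
  exists P, valuation_ring P = local_ring.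
Proof.
move=> e0 tpar.
by exists (Place local_ring_subring local_ring_const local_ring_proper
             (local_ring_total e0 tpar)).
Qed.

Section PointPlace.
Variable P : place (ext_const F).
Hypothesis PE : valuation_ring P = local_ring.

Lemma value_unit_place u : value_unit u -> valuation_units P u.
Proof.
move=> Uu; split; first exact: value_unit_neq0.
  by rewrite PE; have [k _ hu] := Uu; exists k.
by rewrite PE; have [k _ hu] := value_unitV Uu; exists k.
Qed.

Lemma value0_ideal z : has_value z 0 -> maximal_ideal P z.
Proof.
move=> hz; split; first by rewrite PE; exists 0.
case=> z0 _; rewrite PE => -[k hk]; have := valueM hz hk.
by rewrite mul0r divff // => /(value_inj value1) /eqP; rewrite oner_eq0.
Qed.

Lemma point_place_uniformizer t e :
  (0 < e)%N -> local_parameter t e -> uniformizer P t.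
Proof.
move=> e0 tpar; split; first exact: parameter_neq0 tpar.
  by apply: value0_ideal; case: tpar.
move=> z z0; have [n [v Uv ez]] := value_order_exists e0 tpar z0.
by exists n, v => //; apply: value_unit_place.
Qed.

Lemma point_place_order t e :
  local_parameter t e -> has_order P t (polyF ('X - a%:P)) e%:Z.
Proof. by move=> [_ [u Uu ex] _]; exists u => //; apply: value_unit_place. Qed.

(** The local ring at (a, b) lies in every valuation ring centred there, and
    being discrete it is a maximal subring. *)
Lemma point_place_unique t e P' : (0 < e)%N -> local_parameter t e ->
    maximal_ideal P' (polyF ('X - a%:P)) -> maximal_ideal P' (y - ext_const F b) ->
  P = P'.
Proof.
move=> e0 tpar Mx My.
have Ox : valuation_ring P' xF.
  by apply: (@vring_shift _ _ a); rewrite -polyF_const -rmorphB.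
have Oy := vring_shift My.
(* At P' too every polynomial in x and y takes its value at (a, b). *)
have evM G : maximal_ideal P' (evF G - ext_const F (ev_at a b G)).
  have /factor_theorem[G1 eG1] : root (G - G.[b%:P]%:P) b%:P.
    by rewrite /root !hornerE subrr.
  rewrite -[in evF G](subrK G.[b%:P]%:P G) eG1 rmorphD evFC -addrA.
  apply: idealD; last exact: polyF_ideal.
  rewrite rmorphM rmorphB evFX evFC polyF_const; apply: ideal_mull => //.
  exact: vring_evF.
have Oz z : valuation_ring P z -> valuation_ring P' z.
  rewrite PE => -[k [G [H [H1 ez _]]]].
  have UH : valuation_units P' (evF H).
    have := unit_addM (unit1 P') (evM H).
    by rewrite H1 rmorph1 addrC subrK.
  rewrite -(mulfK (unit_neq0 UH) z) ez; apply: vringM (unit_vring (unitV UH)).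
  exact: vring_evF.
apply: (uniformizer_place_eq (point_place_uniformizer e0 tpar) Oz).
have [ht _ _] := tpar; have [G [H [H1 et G0]]] := ht.
have UH : valuation_units P' (evF H).
  have := unit_addM (unit1 P') (evM H).
  by rewrite H1 rmorph1 addrC subrK.
rewrite -(mulfK (unit_neq0 UH) t) et mulrC; apply: ideal_mull.
  exact: unit_vring (unitV UH).
by have := evM G; rewrite G0 rmorph0 subr0.
Qed.

End PointPlace.
End Point.

(** * Classification of the places *)

Hypothesis alpha_inj : injective alpha.
Hypothesis m_neq0 : m%:R != 0 :> K.

Lemma parameter_exists a b : b ^+ m = curve_poly.[a] ->
  exists t e, (0 < e)%N /\ local_parameter a b t e.
Proof.
move=> ab; have [b0|b0] := eqVneq b 0.
  by exists y, m; split=> //; apply: ramified_parameter.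
by exists (polyF ('X - a%:P)), 1%N; split=> //; apply: unramified_parameter.
Qed.

Lemma vring_y P : valuation_ring P xF -> valuation_ring P y.
Proof.
move=> Ox; apply: (@vring_root _ _ _ _ _ m.-1); rewrite prednK // y_eq.
exact: vring_polyF.
Qed.

(** If no x - a were a nonunit then K(x), hence by integrality all of F, would
    lie in the valuation ring. *)
Lemma place_centre P : valuation_ring P xF ->
  exists a b, [/\ b ^+ m = curve_poly.[a], maximal_ideal P (polyF ('X - a%:P))
                & maximal_ideal P (y - ext_const F b)].
Proof.
move=> Ox; have Oy := vring_y Ox.
have [a Ma] : exists a, maximal_ideal P (polyF ('X - a%:P)).
  apply: contrapT => noa.
  have Ulin a : valuation_units P (polyF ('X - a%:P)).
    have := @vring_cases _ _ _ P (polyF ('X - a%:P)).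
    case=> [|Ma|//]; first exact: vring_polyF.
    by case: noa; exists a.
  have Upoly n d : (size d <= n)%N -> d != 0 -> valuation_units P (polyF d).
    elim: n d => [|n IH] d; first by rewrite leqn0 size_poly_eq0 => ->.
    move=> sd d0.
    have [sd1|/closed_rootP[a /factor_theorem[q eq]]] := eqVneq (size d) 1%N.
      have /size_poly1P[k k0 ->] : size d == 1%N by apply/eqP.
      by rewrite polyF_const; apply: unit_const.
    have q0 : q != 0 by apply: contra_neq d0 => q0; rewrite eq q0 mul0r.
    rewrite eq rmorphM; apply: unitM => //; apply: IH => //.
    by move: sd; rewrite eq size_Mmonic ?monicXsubC // size_XsubC addn2.
  have [_] := valuation_ring_proper P; apply=> z _.
  have [d [G [d0 _ eG]]] := clear_denominators z.
  have Ud := Upoly _ d (leqnn _) d0.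
  rewrite -(mulKf (unit_neq0 Ud) z) eG; apply: vringM; last exact: vring_evF.
  exact: unit_vring (unitV Ud).
have [s es] := closed_field_poly_normal ('X^m - curve_poly.[a]%:P).
(* y - b is a nonunit for some m-th root b of f(a), because y^m - f(a) is. *)
have fac : 'X^m - (ext_const F curve_poly.[a])%:P =
    \prod_(b <- s) ('X - (ext_const F b)%:P).
  have <- : map_poly (ext_const F) ('X^m - curve_poly.[a]%:P) =
      'X^m - (ext_const F curve_poly.[a])%:P.
    by rewrite rmorphB /= map_polyXn map_polyC.
  rewrite es (monicP (monicXnsubC _ m_gt0)) scale1r rmorph_prod.
  by apply: eq_bigr => b _; exact: map_polyXsubC.
have fac_y : \prod_(b <- s) (y - ext_const F b) =
    polyF curve_poly - ext_const F curve_poly.[a].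
  transitivity ('X^m - (ext_const F curve_poly.[a])%:P).[y]; last first.
    by rewrite -y_eq hornerD hornerN hornerC hornerXn.
  by rewrite fac horner_prod; apply: eq_bigr => b _; rewrite hornerXsubC.
have [||b bs] := @ideal_prod _ _ _ P _ s (fun b => y - ext_const F b).
- by move=> b; apply: vringB => //; apply: vring_const.
- by rewrite fac_y; apply: polyF_ideal.
move=> Mb; exists a, b; split=> //.
have : root ('X^m - curve_poly.[a]%:P) b.
  by rewrite es (monicP (monicXnsubC _ m_gt0)) scale1r root_prod_XsubC.
by rewrite /root !hornerE ?hornerXn subr_eq0 => /eqP.
Qed.

(** A place centred at (a, b) contains the local ring there, which is a maximal
    subring. *)
Lemma place_classification P : valuation_ring P xF ->
  exists a b, b ^+ m = curve_poly.[a] /\ valuation_ring P = local_ring a b.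
Proof.
move=> Ox; have [a [b [ab Mx My]]] := place_centre Ox.
have [t [e [e0 tpar]]] := parameter_exists ab.
have [P' P'E] := point_place_exists ab e0 tpar.
by exists a, b; rewrite -(point_place_unique ab P'E e0 tpar Mx My).
Qed.

(** At a point with b <> 0 the function x - a is a prime element, so its order
    there is 1, which is not a multiple of the degree of the extension. *)
Lemma totally_ramified_branch Q : (2 <= m)%N ->
    valuation_ring Q xF -> totally_ramified Q ->
  exists a, curve_poly.[a] = 0 /\ valuation_ring Q = local_ring a 0.
Proof.
move=> m2 Ox [P [_ ram]]; have [a [b [ab QE]]] := place_classification Ox.
have [b0|b0] := eqVneq b 0; first by exists a; rewrite -ab -b0 QE b0 expr0n gtn_eqF.
have tpar := unramified_parameter ab m_neq0 b0.
have ut := point_place_uniformizer ab QE (ltn0Sn 0) tpar.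
have vt := valuation_order (uniformizer_prime ut) (point_place_order ab QE tpar).
have := ram (tofrac ('X - a%:P)); rewrite tofrac_eq0 polyXsubC_eq0 => /(_ isT).
rewrite polyF_alg vt.
have := dim_gt1 m2; move: (valuation _ _) (\dim _) => v n n2.
move/(congr1 absz); rewrite abszM => /esym/eqP.
rewrite muln_eq1 => /andP[/eqP n1 _].
by move: n2; rewrite -[n]/(absz (Posz n)) n1.
Qed.

(** * Branch points *)

Section BranchPoint.
Variables (P : place (ext_const F)) (a : K).
Hypothesis a_branch : curve_poly.[a] = 0.
Hypothesis PE : valuation_ring P = local_ring a 0.

Let ab : 0 ^+ m = curve_poly.[a].
Proof. by rewrite a_branch expr0n gtn_eqF. Qed.

Let y_par : local_parameter a 0 y m.
Proof. exact: ramified_parameter. Qed.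

Lemma branch_uniformizer : uniformizer P y.
Proof. exact: point_place_uniformizer m_gt0 y_par. Qed.

Lemma branch_order_x : has_order P y (polyF ('X - a%:P)) m%:Z.
Proof. exact: point_place_order y_par. Qed.

Lemma branch_order_polyF d :
  d != 0 -> has_order P y (polyF d) (m%:Z * (mup a d)%:Z).
Proof.
have [k [q]] := multiplicity_XsubC d a => + ed d0; rewrite d0 implyTb => qa.
rewrite ed mupMr // mup_XsubCX eqxx rmorphM rmorphXn.
rewrite -[X in has_order _ _ _ X]add0r.
have [y0 My _] := branch_uniformizer.
apply: orderM => //; last exact/orderX/branch_order_x.
by apply/order_unit/(polyF_unit _ qa)/(order_ideal My branch_order_x).
Qed.

(** The order of g_i(x) y^i, where x - a has order m and y has order 1. *)
Definition branch_order G (i : 'I_m) : int :=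
  m%:Z * (mup a G`_i)%:Z + 1 * i%:Z.

Lemma branch_order_inj G : injective (branch_order G).
Proof.
move=> i j; rewrite /branch_order => /(congr1 (modz^~ m%:Z)).
rewrite /= !mul1r ![m%:Z * _]mulrC !modzMDl !modz_small ?ltz_nat ?ltn_ord //.
by case=> /val_inj.
Qed.

Lemma evF_order_branch G : (size G <= m)%N -> G != 0 ->
  exists l : 'I_m, [/\ G`_l != 0,
    forall i : 'I_m, G`_i != 0 -> branch_order G l <= branch_order G i
  & has_order P y (evF G) (branch_order G l)].
Proof.
move=> sG G0; have [l Gl lmin] := min_term sG G0 (@branch_order_inj G).
have [y0 My _] := branch_uniformizer.
exists l; split=> // [i Gi|].
  by have [->//|il] := eqVneq i l; apply/ltW/lmin.
apply: evF_order => // i Gi; apply: orderM => //; first exact: branch_order_polyF.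
exact/orderX/order_self.
Qed.

Lemma branch_place_unique P' : maximal_ideal P' (polyF ('X - a%:P)) -> P' = P.
Proof.
move=> Mx; apply/esym/(point_place_unique ab PE m_gt0 y_par) => //.
rewrite rmorph0 subr0; apply: (@ideal_root _ _ _ _ _ m.-1).
rewrite prednK // y_eq; have := polyF_ideal curve_poly Mx.
by rewrite a_branch rmorph0 subr0.
Qed.

End BranchPoint.

(** * Clearing denominators away from one point *)

Lemma separable_binomial (k : K) : k != 0 -> separable_poly ('X^m - k%:P).
Proof.
move=> k0; rewrite unlock derivB derivXn derivC subr0.
rewrite -scaler_nat coprimepZr // coprimep_expr // coprimepX.
by rewrite rootE hornerD hornerN hornerC hornerXn expr0n gtn_eqF // sub0r oppr_eq0.
Qed.

(** Above an unramified value of x there are m points, more than a polynomial in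
    y of degree below m can vanish at. *)
Lemma unramified_coef_eq0 a G : (size G <= m)%N -> curve_poly.[a] != 0 ->
    (forall b, b ^+ m = curve_poly.[a] -> ev_at a b G = 0) ->
  forall i, (G`_i).[a] = 0.
Proof.
move=> sG fa Gz; set k := curve_poly.[a] in fa Gz.
have [s es] := closed_field_poly_normal ('X^m - k%:P).
rewrite (monicP (monicXnsubC _ m_gt0)) scale1r in es.
have us : uniq s by rewrite -separable_prod_XsubC -es separable_binomial.
have ss : size s = m.
  by apply: succn_inj; rewrite -(size_prod_XsubC s id) -es size_XnsubC.
pose p := map_poly (horner_eval a) G.
have p0 : p = 0.
  apply: contraTeq sG => p0; rewrite -ltnNge -ss.
  apply: leq_trans _ (size_poly (size G) _ : (size p <= size G)%N).
  apply: max_poly_roots => //.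
  apply/allP => b; rewrite -root_prod_XsubC -es rootE hornerD hornerN hornerC.
  rewrite hornerXn subr_eq0 => /eqP/Gz Gb.
  by rewrite rootE -[b](hornerC _ a) (horner_map (horner_eval a)); apply/eqP.
by move=> i; have := coef_map (horner_eval a) G i; rewrite -/p p0 coef0.
Qed.

(** Here y is a prime element and the order of G(x, y) is at least m, that of
    x - a. No term has a smaller order than the sum, and y^i with i < m
    contributes less than m, so the coefficients vanish at a. *)
Lemma ramified_coef_eq0 a z d G : (size G <= m)%N -> curve_poly.[a] = 0 ->
    local_ring a 0 z -> d.[a] = 0 -> polyF d * z = evF G ->
  forall i, (G`_i).[a] = 0.
Proof.
move=> sG fa lz da eG.
have [->|G0] := eqVneq G 0; first by move=> i; rewrite coef0 horner0.
have ab : 0 ^+ m = curve_poly.[a] by rewrite fa expr0n gtn_eqF.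
have ypar := ramified_parameter ab (erefl _) alpha_inj.
have [P PE] := point_place_exists ab m_gt0 ypar.
have [l [_ lmin hl]] := evF_order_branch fa PE sG G0.
have [y0 My _] := branch_uniformizer fa PE.
have hx := branch_order_x fa PE.
have lm : m%:Z <= branch_order a G l.
  rewrite -subr_ge0; apply: (vring_order y0 My (orderM y0 hl (orderV hx))).
  have /factor_theorem[q eq] : root d a by apply/eqP.
  rewrite -eG eq rmorphM mulrAC mulfK ?polyF_eq0 ?polyXsubC_eq0 //.
  apply: vringM; last by rewrite PE.
  by rewrite PE; exists q.[a]; apply: value_polyF.
move=> i; have [im|im] := ltnP i m; last first.
  by rewrite nth_default ?horner0 // (leq_trans sG).
have [->|Gi] := eqVneq G`_i 0; first by rewrite horner0.
have := le_trans lm (lmin (Ordinal im) Gi); rewrite /branch_order /= => mi.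
apply/eqP; rewrite -[_ == 0]/(root G`_i a) root_factor_theorem XsubC_dvd //.
by rewrite lt0n; apply/eqP => mu0; rewrite mu0 in mi; lia.
Qed.

Lemma regular_coef_eq0 a z d G : (size G <= m)%N ->
    (forall b, b ^+ m = curve_poly.[a] -> local_ring a b z) ->
    d.[a] = 0 -> polyF d * z = evF G ->
  forall i, (G`_i).[a] = 0.
Proof.
move=> sG lz da eG; have [fa|fa] := eqVneq curve_poly.[a] 0.
  by apply: ramified_coef_eq0 da eG => //; apply: lz; rewrite fa expr0n gtn_eqF.
apply: unramified_coef_eq0 => // b ab; have [k hk] := lz b ab.
have := valueM (value_polyF a b d) hk; rewrite da mul0r eG.
exact: value_inj (value_evF a b G).
Qed.

(** A function without poles at affine points above values of x other than a
    becomes a polynomial in x and y after multiplication by a power of x - a. *)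
Lemma clear_denominators_at a z :
    (forall a' b, a' != a -> b ^+ m = curve_poly.[a'] -> local_ring a' b z) ->
  exists k G, (size G <= m)%N /\ polyF ('X - a%:P) ^+ k * z = evF G.
Proof.
move=> lz; have [d [G [d0 sG eG]]] := clear_denominators z.
have [k [q]] := multiplicity_XsubC d a; rewrite d0 implyTb => qa ed.
rewrite ed in eG; exists k.
(* q is what remains of the denominator; strip off its roots one by one. *)
have [n] := ubnP (size q); elim: n => // n IH in q qa G sG eG {d d0 ed} *.
rewrite ltnS => sq.
have q0 : q != 0 by apply: contraNneq qa => ->; apply: root0.
have [/eqP/size_poly1P[c c0 ec]|/closed_rootP[a' ra']] := eqVneq (size q) 1%N.
  exists ((c^-1)%:P%:P * G); split.
    by rewrite mul_polyC (leq_trans (size_scale_leq _ _)).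
  rewrite rmorphM evFC -eG ec rmorphM rmorphXn !mulrA.
  by rewrite -rmorphM -polyCM mulVf // rmorph1 mul1r.
have aa : a' != a by apply: contraNneq qa => <-.
have da : (q * ('X - a%:P) ^+ k).[a'] = 0.
  by rewrite hornerM (eqP ra') mul0r.
have Gz := regular_coef_eq0 sG (fun b => lz a' b aa) da eG.
have /factor_theorem[q1 eq1] := ra'.
pose G1 := \poly_(i < m) (G`_i %/ ('X - a'%:P)).
have eG1 : G = ('X - a'%:P)%:P * G1.
  apply/polyP => i; rewrite coefCM coef_poly; case: ltnP => im.
    by rewrite mulrC divpK // -root_factor_theorem /root Gz.
  by rewrite nth_default ?mulr0 // (leq_trans sG).
apply: (IH q1 _ G1 (size_poly m _)).
- by apply: contra qa; rewrite eq1 rootM => ->.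
- have xa0 : polyF ('X - a'%:P) != 0 by rewrite polyF_eq0 polyXsubC_eq0.
  apply: (mulfI xa0); rewrite -evFC -[RHS]rmorphM -eG1 -eG eq1 evFC !rmorphM.
  by rewrite !mulrA [polyF q1 * _]mulrC.
- apply: leq_trans sq; rewrite eq1 size_Mmonic ?monicXsubC //.
    by rewrite size_XsubC addn2.
  by apply: contra_neq q0 => q10; rewrite eq1 q10 mul0r.
Qed.

(** * The Weierstrass semigroup at a branch point *)

Section Semigroup.
Variables (Q : place (ext_const F)) (a : K).
Hypothesis a_branch : curve_poly.[a] = 0.
Hypothesis QE : valuation_ring Q = local_ring a 0.

Notation xa := (polyF ('X - a%:P)).

Let xa_neq0 : xa != 0.
Proof. by rewrite polyF_eq0 polyXsubC_eq0. Qed.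

(** Away from Q the function y^i / (x - a)^k is regular: its m-th power is a
    product of ratios (x - alpha_j) / (x - a) and of powers of 1 / (x - a). *)
Lemma semigroup_mem (i k : nat) : (i < m)%N -> (r * i <= m * k)%N ->
  weierstrass_semigroup Q (m * k - i)%N.
Proof.
move=> im rik; exists (y ^+ i / xa ^+ k).
split; first by rewrite mulf_neq0 ?invr_eq0 ?expf_neq0 ?y_neq0.
have [y0 My _] := branch_uniformizer a_branch QE.
have uy := branch_uniformizer a_branch QE.
apply: funext => P; rewrite /pole_divisor /multiple_of_place.
case: asboolP => [->|PQ].
  have hy := orderX i y0 (order_self Q y).
  have hx := orderX k y0 (branch_order_x a_branch QE).
  rewrite (valuation_order (uniformizer_prime uy) (orderM y0 hy (orderV hx))).
  have r0 : (0 < r)%N.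
    have : (1 < size curve_poly)%N.
      by apply: (@root_size_gt1 _ a); rewrite ?curve_poly_neq0 //; apply/eqP.
    by rewrite size_curve_poly.
  by have : (i <= m * k)%N; [exact: leq_trans (leq_pmull _ r0) rik | lia].
suff Oz : valuation_ring P (y ^+ i / xa ^+ k).
  by have := vring_valuation Oz; lia.
have OxV : valuation_ring P xa^-1.
  apply: contrapT => /notin_vringV; rewrite invrK.
  by move=> /(branch_place_unique a_branch QE).
have Olin k' : valuation_ring P (polyF ('X - k'%:P) / xa).
  have -> : 'X - k'%:P = ('X - a%:P) + (a - k')%:P by rewrite polyCB addrA subrK.
  rewrite rmorphD polyF_const mulrDl divff //; apply: vringD; first exact: vring1.
  by apply: vringM => //; apply: vring_const.
have Of : valuation_ring P (y ^+ m / xa ^+ r).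
  have -> : y ^+ m / xa ^+ r = \prod_(j < r) (polyF ('X - (alpha j)%:P) / xa).
    by rewrite big_split /= prodr_const card_ord exprVn y_eq rmorph_prod.
  exact: vring_prod.
apply: (@vring_root _ _ _ _ _ m.-1); rewrite prednK //.
have -> : (y ^+ i / xa ^+ k) ^+ m =
    (y ^+ m / xa ^+ r) ^+ i * (xa^-1) ^+ (m * k - r * i).
  rewrite !exprMn -!exprVn -!exprM -mulrA -exprD subnKC //.
  by rewrite mulnC [(k * m)%N]mulnC.
by apply: vringM; apply: vringX.
Qed.

(** The pole at Q bounds from below the degree of the coefficient of y^i in
    (x - a)^k z, and regularity at infinity bounds it from above. *)
Lemma gap_mem (i j s : nat) : (i < m)%N -> (m * j < r * i)%N ->
  (s + i = m * j)%N -> ~ weierstrass_semigroup Q s.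
Proof.
move=> im jri sij [z [z0 ez]].
have s0 : (0 < s)%N by case: j jri sij => [|j]; nia.
have uy := branch_uniformizer a_branch QE; have [y0 My yord] := uy.
have hxa := branch_order_x a_branch QE.
have [n hz] := yord z z0.
have ns : n = - s%:Z.
  have := congr1 (@^~ Q) ez; rewrite /pole_divisor /multiple_of_place asboolT //.
  by rewrite (valuation_order (uniformizer_prime uy) hz); lia.
have vP P : P <> Q -> 0 <= valuation P z.
  move=> PQ; have := congr1 (@^~ P) ez.
  by rewrite /pole_divisor /multiple_of_place asboolF //; lia.
have [a' b aa ab|k [G [sG eG]]] := @clear_denominators_at a z.
  have [t [e [e0 tpar]]] := parameter_exists ab.
  have [P PE] := point_place_exists ab e0 tpar.
  rewrite -PE; apply: (uniformizer_vring (point_place_uniformizer ab PE e0 tpar)).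
  apply: vP => PQ; rewrite {}PQ in PE.
  have hv : has_value a' b xa (a' - a).
    by have := value_polyF a' b ('X - a%:P); rewrite !hornerE.
  have m0 : (0 : int) < m%:Z by rewrite ltz_nat.
  have [_ []] := order_ideal My hxa m0; apply: (value_unit_place ab PE).
  by exists (a' - a); rewrite // subr_eq0.
have G0 : G != 0.
  apply: contra_neq z0 => G0; move/eqP: eG.
  by rewrite G0 rmorph0 mulf_eq0 expf_eq0 (negPf xa_neq0) andbF => /eqP.
(* Orders at Q modulo m single out the term in y^i. *)
have [l [Gl _ hl]] := evF_order_branch a_branch QE sG G0.
have := order_inj y0 My hl; rewrite -eG.
move/(_ _ (orderM y0 (orderX k y0 hxa) hz)); rewrite /branch_order ns => e.
have il : l = i :> nat.
  have : (m%:Z * (mup a G`_l)%:Z + l%:Z = m%:Z * (k%:Z - j%:Z) + i%:Z)%R by lia.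
  move=> /(congr1 (modz^~ m%:Z)) /=.
  rewrite ![m%:Z * _]mulrC !modzMDl !modz_small ?ltz_nat ?ltn_ord //.
  by case.
pose g := G`_l.
have degG : (mup a g < size g)%N.
  have : ('X - a%:P) ^+ (mup a g) %| g by rewrite -mup_geq.
  by move/(dvdp_leq Gl); rewrite size_exp_XsubC.
(* The degree of g makes that term too large at infinity for z to be regular. *)
have [t t0 ht] := pole_uniformizer.
have [l' [l'min /(_ _ Qinf_pole) hl']] := evF_order_pole (conj t0 ht) sG G0.
have ut := pole_place_uniformizer (conj t0 ht) Qinf_pole.
have [Mt hx _] := ht _ Qinf_pole.
have Oz : valuation_ring Qinf z.
  apply: (uniformizer_vring ut); apply: vP => QQ; apply: Qinf_pole; rewrite QQ QE.
  by exists a; have := value_polyF a 0 'X; rewrite hornerX.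
have [_ _ /(_ z z0)[nz hz']] := ut; have nz0 := vring_order t0 Mt hz' Oz.
have m0 : (0 : int) < m%:Z by rewrite ltz_nat.
have hxa' := polyF_order_pole t0 Mt m0 hx (negbT (polyXsubC_eq0 a)).
rewrite size_XsubC mulr1 in hxa'.
have := order_inj t0 Mt hl'; rewrite -eG.
move/(_ _ (orderM t0 (orderX k t0 hxa') hz')) => e'.
have := l'min l Gl; rewrite e' /pole_order_at_infinity -/g il.
move: e degG; rewrite -/g il; move: (mup _ _) (size _) => mu sz e degG inf_le.
have mk : (m * mu + m * j = m * k)%N by lia.
have : (m * mu <= m * sz.-1)%N by rewrite leq_mul2l; lia.
by lia.
Qed.

End Semigroup.

(** Dividing s by m writes it as m j - i with 0 <= i < m, and the
    cases r i <= m j and m j < r i are decided by [semigroup_mem] and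
    [gap_mem]. *)
Lemma gap_setP (Q : place (ext_const F)) (a : K) (s : nat) :
    curve_poly.[a] = 0 -> valuation_ring Q = local_ring a 0 ->
  gap_set Q s <->
  exists i j : nat, [/\ (i < m)%N, (m * j < r * i)%N & (s + i = m * j)%N].
Proof.
move=> fa QE; split=> [gap|[i [j [im jri sij]]]]; last first.
  exact: (gap_mem fa QE im jri sij).
(* j is s / m rounded up. *)
pose j := ((s + m.-1) %/ m)%N.
have sj : (m.-1 + s = m * j + (s + m.-1) %% m)%N.
  by rewrite /j addnC [(m * _)%N]mulnC -divn_eq.
have jm : ((s + m.-1) %% m < m)%N by rewrite ltn_mod.
pose i := (m.-1 - (s + m.-1) %% m)%N.
have sij : (s + i = m * j)%N by rewrite /i; lia.
have im : (i < m)%N by rewrite /i; lia.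
exists i, j; split=> //; rewrite ltnNge; apply/negP => rij; apply: gap.
by have := semigroup_mem fa QE im rij; rewrite -sij addnK.
Qed.

End Curve.

Theorem proposition4p3
  (Fq : finFieldType) (p : nat) (charFq : p \in [pchar Fq])
  (K : closedFieldType) (emb : {rmorphism Fq -> K})
  (algK : forall a : K, algebraicOver emb a)
  (r m : nat) (alpha : 'I_r -> K) (alpha_inj : injective alpha)
  (m_ge2 : (2 <= m)%N) (p_ndvd_m : ~~ (p %| m)%N) (co_m_r : gcdn m r = 1%N)
  (F : fieldExtType (ratfun K)) (y : F)
  (y_eq : y ^+ m =
     \prod_(i < r) ((ratfun_X K)%:A - ext_const F (alpha i)))
  (F_gen : <<1; y>>%VS = fullv)
  (Px : place (ratfun_const K)) (Px_pole : is_pole Px (ratfun_X K))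
  (Qinf : place (ext_const F)) (Qinf_over : lies_over Qinf Px)
  (Q : place (ext_const F)) (Q_neq : Q <> Qinf)
  (Q_ram : totally_ramified Q) :
  [set s%:Z | s in gap_set Q] =
  [set k : int | exists i j : int,
    [/\ 1 <= j <= r%:Z - 1,
        Num.floor ((j * m%:Z)%:~R / r%:R : rat) + 1 <= i <= m%:Z - 1
      & k = m%:Z * j - i]].
Proof.
have m_gt0 : (0 < m)%N by apply: ltnW.
have co_mr : coprime m r by apply/eqP.
have m_neq0 : m%:R != 0 :> K by rewrite -(dvdn_pcharf (rmorph_pchar emb charFq)).
have y_eq' : y ^+ m = polyF F (curve_poly alpha).
  rewrite y_eq rmorph_prod; apply: eq_bigr => i _.
  by rewrite rmorphB polyF_const -polyF_alg.
have Qinf_pole : ~ valuation_ring Qinf (polyF F 'X).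
  have := valuation_lt0_notin Px_pole; by rewrite Qinf_over /= polyF_alg.
have Ox : valuation_ring Q (polyF F 'X).
  apply: contrapT => /(pole_place_unique m_gt0 co_mr y_eq' F_gen) Qpole.
  exact: Q_neq (Qpole _ Qinf_pole).
have [a [fa QE]] := totally_ramified_branch m_gt0 co_mr y_eq' F_gen Qinf_pole
  alpha_inj m_neq0 m_ge2 Ox Q_ram.
have gapP s := gap_setP m_gt0 co_mr y_eq' F_gen Qinf_pole alpha_inj m_neq0 s fa QE.
have r_gt0 : (0 < r)%N.
  by rewrite lt0n; apply/eqP => r0; move: co_m_r; rewrite r0 gcdn0; lia.
have floorE (i j : int) :
    (Num.floor ((j * m%:Z)%:~R / r%:R : rat) + 1 <= i) = (j * m%:Z < i * r%:Z).
  rewrite lezD1 floor_lt_int ltr_pdivrMr ?ltr0n //.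
  by rewrite -[r%:R]/((r%:Z)%:~R) -intrM ltr_int.
apply/seteqP; split=> [_ [s /gapP[i [j [im jri sij]]] <-]|_ [i [j [jr + ->]]]] /=.
  exists i%:Z, j%:Z; rewrite floorE; split; last by lia.
  - by apply/andP; split; nia.
  - by apply/andP; split; nia.
rewrite floorE => ir.
case: j i jr ir => [j|j] [i|i] jr ir; try by lia.
exists (m * j - i)%N; last by nia.
by apply/gapP; exists i, j; split; nia.
Qed.
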